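(* Let $r\geq 2$ be an integer and let $G$ be an $r$-partite graph which satisfies the condition $(\ast)$ for $r$, with parts $V_{i}=\{x_{1i},\ldots,x_{ni}\}$ $(1\leq i\leq r)$ as in the definition of $(\ast)$. Then $G$ is unmixed if and only if the following condition holds: for every $1\leq q\leq n$, if $\{x_{k_{1}s_{1}},\ldots,x_{k_{r}s_{r}}\}$ is a set of (not necessarily distinct) vertices of $G$ such that $$x_{k_{1}s_{1}}\sim x_{q1},\ \ldots,\ x_{k_{r}s_{r}}\sim x_{qr},$$ then the set $\{x_{k_{1}s_{1}},\ldots,x_{k_{r}s_{r}}\}$ is not independent.
   Context: All graphs are finite and simple, with vertex set $V(G)$ and edge set $E(G)$; $x\sim y$ means $\{x,y\}\in E(G)$. A vertex cover of $G$ is a subset $C\subseteq V(G)$ such that every edge of $G$ has at least one endpoint in $C$; it is minimal if no proper subset of $C$ is a vertex cover. $G$ is unmixed if all minimal vertex covers of $G$ have the same number of elements. A subset $H\subseteq V(G)$ is independent if no edge $\{x,y\}$ of $G$ satisfies $\{x,y\}\subseteq H$. A clique is a set of vertices any two distinct elements of which are adjacent. For an integer $r\geq 2$, $G$ is $r$-partite if $V(G)$ can be partitioned into $r$ disjoint parts such that for every edge $\{x,y\}\in E(G)$, $x$ and $y$ do not lie in the same part. Condition $(\ast)$ for an integer $r\geq 2$: $V(G)$ can be partitioned into $r$ pairwise disjoint parts $V_{i}=\{x_{1i},\ldots,x_{ni}\}$, $1\leq i\leq r$, each with $n$ distinct vertices and each containing no edge of $G$ (i.e. this is an $r$-partition of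 $G$), such that for all $1\leq j\leq n$ the set $\{x_{j1},\ldots,x_{jr}\}$ is a clique. *)

(* Defs.v *)
From mathcomp Require Import all_boot.

Set Implicit Arguments.
Unset Strict Implicit.
Unset Printing Implicit Defensive.

(* A finite simple graph is given by its vertex type [T] and a symmetric,
   irreflexive adjacency relation [e : rel T]. *)

Section Graphs.
Variables (T : finType) (e : rel T).

Definition simple_graph : Prop := symmetric e /\ irreflexive e.

Definition vertex_cover (C : {set T}) : bool :=
  [forall x, forall y, e x y ==> (x \in C) || (y \in C)].

Definition minimal_vertex_cover (C : {set T}) : bool := minset vertex_cover C.

Definition unmixed : Prop :=
  forall C D : {set T},
    minimal_vertex_cover C -> minimal_vertex_cover D -> #|C| = #|D|.

Definition independent (H : {set T}) : bool :=
  [forall x in H, forall y in H, ~~ e x y].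

Definition clique (K : {set T}) : bool :=
  [forall x in K, forall y in K, (x != y) ==> e x y].

(* The parts are an indexed family, so some of them may be empty: MathComp's
   [partition] would forbid that. *)
Definition r_partition (r : nat) (V : 'I_r -> {set T}) : Prop :=
  [/\ forall i j : 'I_r, i != j -> [disjoint V i & V j],
      \bigcup_(i < r) V i = [set: T]
    & forall (i : 'I_r) (x y : T), e x y -> ~~ ((x \in V i) && (y \in V i))].

Definition r_partite (r : nat) : Prop :=
  exists V : 'I_r -> {set T}, r_partition V.

(* [x j i] is the vertex x_{ji}: [i] indexes the part, [j] the position in it;
   both indices start from 0. *)
Definition part (n r : nat) (x : 'I_n -> 'I_r -> T) (i : 'I_r) : {set T} :=
  [set x j i | j : 'I_n].

Definition cond_star (n r : nat) (x : 'I_n -> 'I_r -> T) : Prop :=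
  [/\ r_partition (part x),
      forall i : 'I_r, injective (fun j : 'I_n => x j i)
    & forall j : 'I_n, clique [set x j i | i : 'I_r]].

End Graphs.

(* Main.v *)
Require Import Defs.
From mathcomp Require Import all_boot.

(** A vertex cover is minimal exactly when its complement is a maximal
    independent set, so [unmixed] says that all maximal independent sets have
    the same size (lemma [unmixed_maxset]).

    By condition (∗) the vertex set is a disjoint union of [n] cliques, the
    rows [{x q i | i}], and the function [pos] sending a vertex to its row is
    injective on every independent set. An independent set therefore has at
    most [n] elements, with equality exactly when it meets every row. The first
    part is independent with [n] elements, so [G] is unmixed if and only if
    every maximal independent set meets every row ([unmixed_meets_rows]).

    Finally, a maximal independent set [M] misses the row [q] if and only if
    each [x q i] has a neighbour in [M]. So [M] missing row [q] provides an
    independent choice of neighbours of the [x q i]; conversely, an independent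
    choice of such neighbours extends to a maximal independent set, which then
    misses row [q]. *)

Section IndependentSets.
Local Set Implicit Arguments.
Local Unset Strict Implicit.
Variables (T : finType) (e : rel T).

Lemma independentP (H : {set T}) :
  reflect {in H &, forall y z, ~~ e y z} (independent e H).
Proof.
apply: (iffP forall_inP) => [Hind y z yH zH | Hind y yH].
  exact: (forall_inP (Hind y yH)).
by apply/forall_inP => z zH; apply: Hind.
Qed.

Lemma independentS (H K : {set T}) :
  H \subset K -> independent e K -> independent e H.
Proof.
move=> /subsetP HK /independentP Kind; apply/independentP => y z yH zH.
by apply: Kind; apply: HK.
Qed.

Lemma vertex_cover_setC (C : {set T}) :
  vertex_cover e C = independent e (~: C).
Proof.
apply/idP/independentP => [/forallP cov y z | ind].
  rewrite !inE => yC zC; apply/negP => eyz.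
  by have := forallP (cov y) z; rewrite eyz (negPf yC) (negPf zC).
apply/forallP => y; apply/forallP => z; apply/implyP => eyz.
apply: contraLR eyz; rewrite negb_or => /andP[yC zC].
by apply: ind; rewrite inE.
Qed.

Lemma minimal_vertex_cover_setC (C : {set T}) :
  minimal_vertex_cover e C = maxset (independent e) (~: C).
Proof.
apply/minsetP/maxsetP => -[]; rewrite vertex_cover_setC => Cind Cmin.
  split=> // B Bind CB; rewrite -(Cmin (~: B)) ?setCK //.
    by rewrite vertex_cover_setC setCK.
  by rewrite -setCS setCK.
split=> // B; rewrite vertex_cover_setC => Bind BC.
by apply: setC_inj; apply: Cmin; rewrite ?setCS.
Qed.

Lemma unmixed_maxset :
  unmixed e <->
  (forall M N : {set T}, maxset (independent e) M ->
     maxset (independent e) N -> #|M| = #|N|).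
Proof.
split=> [unm M N maxM maxN | eqc C D].
  have := unm (~: M) (~: N); rewrite !minimal_vertex_cover_setC !setCK.
  move=> /(_ maxM maxN) eqMN; apply/eqP.
  by rewrite -(eqn_add2r #|~: M|) {2}eqMN !cardsC.
rewrite !minimal_vertex_cover_setC => maxC maxD; apply/eqP.
by rewrite -(eqn_add2r #|~: C|) {2}(eqc _ _ maxC maxD) !cardsC.
Qed.

Lemma maxset_independent_neighbour (M : {set T}) (y : T) :
  simple_graph e -> maxset (independent e) M -> y \notin M ->
  exists2 z, z \in M & e z y.
Proof.
move=> [symE irrE] /maxsetP[/independentP Mind Mmax] yM.
case: (pickP [pred z | (z \in M) && e z y]) => [z /andP[zM ezy] | no_nbr].
  by exists z.
have nadj z : z \in M -> ~~ e z y.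
  by move=> zM; have := no_nbr z; rewrite /= zM /= => ->.
case/negP: yM; rewrite -(Mmax (y |: M)) ?setU11 ?subsetUr //.
apply/independentP => a b /setU1P[->|aM] /setU1P[->|bM].
- by rewrite irrE.
- by rewrite symE nadj.
- exact: nadj.
- exact: Mind.
Qed.

End IndependentSets.

Section Rows.
Local Set Implicit Arguments.
Local Unset Strict Implicit.
Variables (T : finType) (e : rel T) (r n : nat) (x : 'I_n -> 'I_r -> T).

(** The grid [x] enumerates the vertices bijectively: the parts cover [T] and
    are disjoint, which recovers the column, and [x] is injective within a
    column. The row is given as a function of the vertex, rather than as a
    set, so that counting becomes injectivity of this function. *)
Lemma cond_star_pos :
  cond_star e x ->
  exists pos : T -> 'I_n,
    (forall y, exists i, y = x (pos y) i) /\ (forall q i, pos (x q i) = q).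
Proof.
move=> [[disjV covV _] injx _].
have cov (y : T) : exists j, exists i, y = x j i.
  have: y \in \bigcup_(i < r) part x i by rewrite covV.
  by case/bigcupP => i _ /imsetP[j _ ->]; exists j, i.
have [pos posP] := fin_all_exists cov.
exists pos; split=> // q i.
have [i' eq_x] := posP (x q i).
suff eq_i : i = i' by subst i'; apply: (injx i); rewrite -eq_x.
apply: contraTeq isT => /disjV dis.
have: x q i \in part x i' by rewrite eq_x imset_f.
by rewrite (disjointFr dis) // imset_f.
Qed.

(** Rows are cliques, so two vertices in the same row are equal or adjacent. *)
Lemma pos_inj_independent (pos : T -> 'I_n) (M : {set T}) :
  cond_star e x -> (forall y, exists i, y = x (pos y) i) ->
  independent e M -> {in M &, injective pos}.
Proof.
move=> [_ _ cliques] posP /independentP Mind y z yM zM eq_pos.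
apply/eqP; apply: contraTT isT => neq_yz.
have in_row w : w \in [set x (pos w) i | i : 'I_r].
  by have [i {1}->] := posP w; rewrite imset_f.
have zrow := in_row z; rewrite -eq_pos in zrow.
have := forall_inP (forall_inP (cliques (pos y)) y (in_row y)) z zrow.
by rewrite neq_yz (negPf (Mind y z yM zM)).
Qed.

Lemma unmixed_meets_rows :
  cond_star e x -> 0 < r ->
  unmixed e <->
  (forall M : {set T}, maxset (independent e) M ->
     forall q, exists i, x q i \in M).
Proof.
move=> star r_gt0; have [pos [posP pos_x]] := cond_star_pos star.
have card_pos M : independent e M -> #|pos @: M| = #|M|.
  by move=> Mind; apply: card_in_imset; apply: pos_inj_independent.
split=> [/unmixed_maxset unm M maxM q | meets].
  (* The first part shows that the common size is [n]. *)
  pose V0 := part x (Ordinal r_gt0).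
  have [[_ _ V_indep] injx _] := star.
  have V0ind : independent e V0.
    apply/independentP => y z yV zV; apply/negP => /(V_indep (Ordinal r_gt0)).
    by rewrite -/V0 yV zV.
  have [N maxN V0N] := maxset_exists V0ind.
  have cardM : n <= #|pos @: M|.
    rewrite card_pos ?(maxsetp maxM) // (unm M N) //.
    by rewrite -{1}[n]card_ord -(card_imset _ (injx (Ordinal r_gt0)))
      subset_leq_card.
  have : q \in pos @: M.
    have /eqP -> : pos @: M == setT by rewrite eqEcard subsetT cardsT card_ord.
    by rewrite inE.
  case/imsetP => y yM ->; have [i eq_y] := posP y.
  by exists i; rewrite -eq_y.
apply/unmixed_maxset.
suff cardM M : maxset (independent e) M -> #|M| = n.
  by move=> M N /cardM -> /cardM ->.
move=> maxM; rewrite -card_pos ?(maxsetp maxM) //.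
suff -> : pos @: M = setT by rewrite cardsT card_ord.
apply/setP => q; rewrite inE; have [i xM] := meets M maxM q.
by apply/imsetP; exists (x q i).
Qed.

End Rows.

Theorem theorem2p3 (T : finType) (e : rel T) (r n : nat)
    (x : 'I_n -> 'I_r -> T)
    (he : simple_graph e) (hr : 2 <= r)
    (hpart : r_partite e r) (hstar : cond_star e x) :
  unmixed e <->
  (forall (q : 'I_n) (k : 'I_r -> 'I_n) (s : 'I_r -> 'I_r),
     (forall i : 'I_r, e (x (k i) (s i)) (x q i)) ->
     ~~ independent e [set x (k i) (s i) | i : 'I_r]).
Proof.
apply: iff_trans (unmixed_meets_rows hstar (ltnW hr)) _.
split=> [meets q k s adj | cond M maxM q].
  apply/negP => Hind; have [M maxM /subsetP HM] := maxset_exists Hind.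
  have [i xM] := meets M maxM q.
  have /independentP Mind := maxsetp maxM.
  have yM : x (k i) (s i) \in M by apply: HM; rewrite imset_f.
  by have := Mind _ _ yM xM; rewrite adj.
apply/existsP; apply: contraT; rewrite negb_exists => /forallP miss.
have [pos [posP _]] := cond_star_pos hstar.
have nbr i : exists j, exists i', x j i' \in M /\ e (x j i') (x q i).
  have [z zM ez] := maxset_independent_neighbour he maxM (miss i).
  by have [i' eq_z] := posP z; exists (pos z), i'; rewrite -eq_z.
have [k /fin_all_exists[s ksP]] := fin_all_exists nbr.
case/negP: (cond q k s (fun i => (ksP i).2)).
apply: independentS (maxsetp maxM).
by apply/subsetP => _ /imsetP[i _ ->]; case: (ksP i).
Qed.
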